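(* Let $(M,g)$ be a Riemannian manifold of dimension $n\ge 1$ and let $p\in M$. The M-eigenvalues of the Riemann curvature tensor at $p$ always exist, are real, and are invariants of the Riemann curvature tensor. That is: (i) there is at least one M-eigenvalue of the Riemann curvature tensor at $p$; (ii) every scalar $\theta$ (a priori in $\mathbb{C}$) for which there are real vectors $u,v\in T_pM$ satisfying the M-eigenvalue equations is real; (iii) the set of M-eigenvalues, when computed from the component equations $$R_{hijk}u^iv^ju^k=\theta\, g_{hl}v^l,\qquad R_{hijk}v^iu^jv^k=\theta\, g_{hl}u^l,\qquad g_{ij}u^iu^j=g_{ij}v^iv^j=1$$ at $p$ in a local coordinate system, does not depend on the choice of the local coordinate system around $p$.
   Context: Let $\nabla$ be the Levi-Civita connection of $g$ and $\langle\cdot,\cdot\rangle=g$. Convention: $R(X,Y)=[\nabla_X,\nabla_Y]-\nabla_{[X,Y]}$, $R(W,Z,X,Y)=\langle W,R(X,Y)Z\rangle$, and in local coordinates $R_{ijkl}=R(\partial_i,\partial_j,\partial_k,\partial_l)$ (summation convention is used). M-eigenvalue: a scalar $\theta$ is an M-eigenvalue of the Riemann curvature tensor at $p$ if there are (real) vectors $u,v\in T_pM$ with $$R(v,u)u=\theta v,\qquad R(u,v)v=\theta u,\qquad \langle u,u\rangle=\langle v,v\rangle=1.$$ (For complex $\theta$ the equations are read in the complexification of $T_pM$, with $u,v$ still real.) In components these equations are $R_{hijk}u^iv^ju^k=\theta g_{hl}v^l$, $R_{hijk}v^iu^jv^k=\theta g_{hl}u^l$, $g_{ij}u^iu^j=g_{ij}v^iv^j=1$.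 *)

(* Defs.v *)
From HB Require Import structures.
From mathcomp Require Import all_boot all_order all_algebra.
From mathcomp Require Import all_classical all_reals all_analysis.
From mathcomp Require Import complex.

Set Implicit Arguments.
Unset Strict Implicit.
Unset Printing Implicit Defensive.

Import Order.TTheory GRing.Theory Num.Theory.
Import numFieldNormedType.Exports.

Local Open Scope classical_set_scope.
Local Open Scope ring_scope.
Local Open Scope complex_scope.

(* [f] is of class C^k on the open set [D]: C^{k+1} means differentiable with
   all directional derivatives of class C^k. *)
Fixpoint class_C (R : realType) (V W : normedModType R) (k : nat)
    (D : set V) (f : V -> W) : Prop :=
  if k is k'.+1 then
    (forall x, D x -> differentiable f x) /\
    (forall v : V, class_C k' D (fun x => 'D_v f x))
  else forall x, D x -> {for x, continuous f}.

Definition class_Coo (R : realType) (V W : normedModType R)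
    (D : set V) (f : V -> W) : Prop := forall k, class_C k D f.

(* A homeomorphism from an open subset of M onto an open subset of R^n; both
   maps are total functions, irrelevant outside these open sets. *)
Record chart (R : realType) (n : nat) (M : topologicalType) := Chart {
  cdom : set M;
  cmap : M -> 'rV[R]_n;
  cinv : 'rV[R]_n -> M;
  cdom_open : open cdom;
  cran_open : open (cmap @` cdom);
  cmapK : forall q, cdom q -> cinv (cmap q) = q;
  cmap_cont : forall q, cdom q -> {for q, continuous cmap};
  cinv_cont : forall x, (cmap @` cdom) x -> {for x, continuous cinv} }.

Definition compatible (R : realType) (n : nat) (M : topologicalType)
    (c d : chart R n M) : Prop :=
  class_Coo (cmap c @` (cdom c `&` cdom d)) (cmap d \o cinv c) /\
  class_Coo (cmap d @` (cdom c `&` cdom d)) (cmap c \o cinv d).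

(* The local coordinate systems of the manifold are the elements of the
   maximal atlas. *)
Record smooth_manifold (R : realType) (n : nat) (M : topologicalType) :=
  SmoothManifold {
    atlas : set (chart R n M);
    manifold_hausdorff : hausdorff_space M;
    manifold_second_countable : @second_countable M;
    atlas_cover : forall p, exists2 c, atlas c & cdom c p;
    atlas_compatible : forall c d, atlas c -> atlas d -> compatible c d;
    atlas_maximal : forall c,
      (forall d, atlas d -> compatible c d) -> atlas c }.

Definition smooth_on (R : realType) (n : nat) (M : topologicalType)
    (A : smooth_manifold R n M) (U : set M) (f : M -> R) : Prop :=
  forall c, atlas A c ->
    class_Coo (cmap c @` (U `&` cdom c)) (f \o cinv c : 'rV[R]_n -> R).

Definition smooth_near (R : realType) (n : nat) (M : topologicalType)
    (A : smooth_manifold R n M) (p : M) (f : M -> R) : Prop :=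
  exists U, [/\ open U, U p & smooth_on A U f].

(* Tangent vectors are directional derivatives acting on the functions smooth
   near the base point.  Functionals on all of [M -> R] give a vector space
   (pointwise operations) containing every T_pM; a tangent vector at p is
   normalized to vanish on the functions that are not smooth near p, so that
   Leibniz equality of tangent vectors is the right one. *)
Notation functional R M := ((M -> R) -> R) (only parsing).
Notation vecfun R M := (M -> functional R M) (only parsing).

Definition on_smooth (R : realType) (n : nat) (M : topologicalType)
    (A : smooth_manifold R n M) (p : M) (v : functional R M) : functional R M :=
  fun f => if `[< smooth_near A p f >] then v f else 0.

(* sum_i a_i d/dx^i at p, in the coordinates x of the chart c *)
Definition coord_vec (R : realType) (n : nat) (M : topologicalType)
    (A : smooth_manifold R n M) (c : chart R n M) (p : M) (a : 'rV[R]_n) :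
    functional R M :=
  on_smooth A p (fun f => 'D_a (f \o cinv c : 'rV[R]_n -> R) (cmap c p)).

Definition tangent (R : realType) (n : nat) (M : topologicalType)
    (A : smooth_manifold R n M) (p : M) : set (functional R M) :=
  [set v | exists c a, [/\ atlas A c, cdom c p & v = coord_vec A c p a]].

(* [X] is a smooth vector field on the open set [U]; its values outside [U]
   are irrelevant. *)
Definition vfield_on (R : realType) (n : nat) (M : topologicalType)
    (A : smooth_manifold R n M) (U : set M) (X : vecfun R M) : Prop :=
  (forall p, U p -> tangent A p (X p)) /\
  (forall (V : set M) (f : M -> R), open V -> V `<=` U ->
     smooth_on A V f -> smooth_on A V (fun q => X q f)).

Definition coord_field (R : realType) (n : nat) (M : topologicalType)
    (A : smooth_manifold R n M) (c : chart R n M) (i : 'I_n) :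
    vecfun R M :=
  fun q => coord_vec A c q (delta_mx 0 i).

Definition lie_bracket (R : realType) (n : nat) (M : topologicalType)
    (A : smooth_manifold R n M) (X Y : vecfun R M) :
    vecfun R M :=
  fun p => on_smooth A p
    (fun f => X p (fun q => Y q f) - Y p (fun q => X q f)).

Record riemannian_metric (R : realType) (n : nat) (M : topologicalType)
    (A : smooth_manifold R n M)
    (g : M -> functional R M -> functional R M -> R) : Prop := {
  metric_sym : forall p u v, tangent A p u -> tangent A p v ->
    g p u v = g p v u;
  metric_lin : forall p (a : R) u v w,
    tangent A p u -> tangent A p v -> tangent A p w ->
    g p (a *: u + v) w = a * g p u w + g p v w;
  metric_pos : forall p u, tangent A p u -> u != 0 -> 0 < g p u u;
  metric_smooth : forall U X Y, open U -> vfield_on A U X -> vfield_on A U Y ->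
    smooth_on A U (fun p => g p (X p) (Y p)) }.

(* A connection acts on vector fields defined on any open set: [nabla X Y] is
   meaningful wherever [X] and [Y] are smooth, and is local.  The last two
   fields are the two properties characterizing the Levi-Civita connection
   among all affine connections. *)
Record levi_civita (R : realType) (n : nat) (M : topologicalType)
    (A : smooth_manifold R n M)
    (g : M -> functional R M -> functional R M -> R)
    (nabla : vecfun R M -> vecfun R M -> vecfun R M) : Prop := {
  nabla_vfield : forall U X Y, open U -> vfield_on A U X -> vfield_on A U Y ->
    vfield_on A U (nabla X Y);
  nabla_local : forall U X X' Y Y', open U ->
    vfield_on A U X -> vfield_on A U X' ->
    vfield_on A U Y -> vfield_on A U Y' ->
    (forall q, U q -> X q = X' q) -> (forall q, U q -> Y q = Y' q) ->
    forall q, U q -> nabla X Y q = nabla X' Y' q;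
  nabla_addl : forall U X X' Y, open U ->
    vfield_on A U X -> vfield_on A U X' -> vfield_on A U Y ->
    forall q, U q -> nabla (X + X') Y q = nabla X Y q + nabla X' Y q;
  nabla_scalel : forall U (f : M -> R) X Y, open U ->
    smooth_on A U f -> vfield_on A U X -> vfield_on A U Y ->
    forall q, U q -> nabla (fun r => f r *: X r) Y q = f q *: nabla X Y q;
  nabla_addr : forall U X Y Y', open U ->
    vfield_on A U X -> vfield_on A U Y -> vfield_on A U Y' ->
    forall q, U q -> nabla X (Y + Y') q = nabla X Y q + nabla X Y' q;
  nabla_leibniz : forall U (f : M -> R) X Y, open U ->
    smooth_on A U f -> vfield_on A U X -> vfield_on A U Y ->
    forall q, U q -> nabla X (fun r => f r *: Y r) q =
                     X q f *: Y q + f q *: nabla X Y q;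
  nabla_torsion_free : forall U X Y, open U ->
    vfield_on A U X -> vfield_on A U Y ->
    forall q, U q -> nabla X Y q - nabla Y X q = lie_bracket A X Y q;
  nabla_metric : forall U X Y Z, open U ->
    vfield_on A U X -> vfield_on A U Y -> vfield_on A U Z ->
    forall q, U q -> X q (fun r => g r (Y r) (Z r)) =
                     g q (nabla X Y q) (Z q) + g q (Y q) (nabla X Z q) }.

(* R(X,Y)Z for vector fields *)
Definition curv (R : realType) (n : nat) (M : topologicalType)
    (A : smooth_manifold R n M)
    (nabla : vecfun R M -> vecfun R M -> vecfun R M)
    (X Y Z : vecfun R M) : vecfun R M :=
  nabla X (nabla Y Z) - nabla Y (nabla X Z) - nabla (lie_bracket A X Y) Z.

(* R(x,y)z for x, y, z in T_pM: the value at p of R(X,Y)Z, where X, Y, Z are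
   any smooth vector fields near p extending x, y, z. *)
Definition curv_at (R : realType) (n : nat) (M : topologicalType)
    (A : smooth_manifold R n M)
    (nabla : vecfun R M -> vecfun R M -> vecfun R M)
    (p : M) (x y z : functional R M) : functional R M :=
  xget (0 : functional R M) [set w | exists U X Y Z,
    [/\ open U, U p,
        [/\ vfield_on A U X, vfield_on A U Y & vfield_on A U Z],
        [/\ X p = x, Y p = y & Z p = z]
      & w = curv A nabla X Y Z p]].

(* R(W,Z,X,Y) = <W, R(X,Y)Z> *)
Definition curv4 (R : realType) (n : nat) (M : topologicalType)
    (A : smooth_manifold R n M)
    (g : M -> functional R M -> functional R M -> R)
    (nabla : vecfun R M -> vecfun R M -> vecfun R M)
    (W Z X Y : vecfun R M) : M -> R :=
  fun p => g p (W p) (curv A nabla X Y Z p).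

(* w = theta v in the complexification of T_pM (C-valued functionals) *)
Definition complex_multiple (R : realType) (M : topologicalType)
    (w : functional R M) (theta : R[i]) (v : functional R M) : Prop :=
  forall f : M -> R, (w f)%:C = theta * (v f)%:C.

Definition M_eigenvalues (R : realType) (n : nat) (M : topologicalType)
    (A : smooth_manifold R n M)
    (g : M -> functional R M -> functional R M -> R)
    (nabla : vecfun R M -> vecfun R M -> vecfun R M)
    (p : M) : set R[i] :=
  [set theta | exists u v,
    [/\ tangent A p u /\ tangent A p v,
        complex_multiple (curv_at A nabla p v u u) theta v,
        complex_multiple (curv_at A nabla p u v v) theta u
      & g p u u = 1 /\ g p v v = 1]].

Definition metric_coef (R : realType) (n : nat) (M : topologicalType)
    (A : smooth_manifold R n M)
    (g : M -> functional R M -> functional R M -> R)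
    (c : chart R n M) (p : M) (i j : 'I_n) : R :=
  g p (coord_field A c i p) (coord_field A c j p).

Definition curv_coef (R : realType) (n : nat) (M : topologicalType)
    (A : smooth_manifold R n M)
    (g : M -> functional R M -> functional R M -> R)
    (nabla : vecfun R M -> vecfun R M -> vecfun R M)
    (c : chart R n M) (p : M) (i j k l : 'I_n) : R :=
  curv4 A g nabla (coord_field A c i) (coord_field A c j)
    (coord_field A c k) (coord_field A c l) p.

Definition coord_M_eigenvalues (R : realType) (n : nat) (M : topologicalType)
    (A : smooth_manifold R n M)
    (g : M -> functional R M -> functional R M -> R)
    (nabla : vecfun R M -> vecfun R M -> vecfun R M)
    (c : chart R n M) (p : M) : set R[i] :=
  let Rm := curv_coef A g nabla c p in
  let gm := metric_coef A g c p in
  [set theta | exists u v : 'rV[R]_n,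
    [/\ forall h,
          (\sum_i \sum_j \sum_k Rm h i j k * u 0 i * v 0 j * u 0 k)%:C =
          theta * (\sum_l gm h l * v 0 l)%:C,
        forall h,
          (\sum_i \sum_j \sum_k Rm h i j k * v 0 i * u 0 j * v 0 k)%:C =
          theta * (\sum_l gm h l * u 0 l)%:C,
        \sum_i \sum_j gm i j * u 0 i * u 0 j = 1
      & \sum_i \sum_j gm i j * v 0 i * v 0 j = 1]].

(* Main.v *)
Require Import Defs.
From HB Require Import structures.
From mathcomp Require Import all_boot all_order all_algebra.
From mathcomp Require Import all_classical all_reals all_analysis.
From mathcomp Require Import complex.
From mathcomp Require Import ring.

Set Implicit Arguments.
Unset Strict Implicit.
Unset Printing Implicit Defensive.

Import Order.TTheory GRing.Theory Num.Theory.
Import numFieldNormedType.Exports.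

Local Open Scope classical_set_scope.
Local Open Scope ring_scope.
Local Open Scope complex_scope.

(** The vector [R(x,y)z] depends only on the values [x], [y], [z] at [p] of the
    fields extending them: on a chart domain a field is a combination of the
    coordinate fields with smooth coefficients, and the curvature is local and
    linear over smooth functions.  Torsion-freeness expresses Lie brackets
    through [nabla], so brackets need no computation of second derivatives.
    Hence the M-eigenvalue equations expand in any chart, and pairing with the
    coordinate fields loses nothing because the metric is nondegenerate.
    Antisymmetry gives [R(u,u)u = 0], so [theta = 0] is an M-eigenvalue (take
    [v = u]); an eigenvalue is real as it is a quotient of two real numbers. *)

(** * Calculus of functions of class C^k on open sets *)

Lemma near_eq_differentiable (R : numFieldType) (V W : normedModType R)
    (f g : V -> W) (x : V) :
  (\near x, f x = g x) -> differentiable f x -> differentiable g x.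
Proof.
move=> fg df; have fgx := nbhs_singleton fg.
have [dfc /eqaddoP dfo] := (diff_locallyP x f).1 df.
have dgo : forall e, 0 < e -> \forall h \near 0,
    `|(g \o shift x - (cst (g x) + 'd f x)) h| <= e * `|h|.
  move=> e e0; apply: filterS2 ((nbhs0P _ _).1 fg) (dfo e e0) => h.
  by move=> fgh; rewrite !fctE /= fgx [h + x]addrC fgh.
(* The differential is a chosen linear map, so it is identified through its uniqueness in the
   first-order expansion, which [g] shares with [f]. *)
have dgE : 'd g x = 'd f x :> (V -> W) by exact/diff_unique/eqaddoP.
apply/diff_locallyP; rewrite dgE; split; first exact: dfc.
exact/eqaddoP.
Qed.

Section class_C_theory.
Context (R : realType).
Implicit Types V W : normedModType R.

Lemma class_CS V W k (D E : set V) (f : V -> W) :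
  E `<=` D -> class_C k D f -> class_C k E f.
Proof.
move=> ED; elim: k f => [|k IH] f /=; first by move=> fc x /ED /fc.
by case=> fd fD; split=> [x /ED /fd //|v]; exact/IH/fD.
Qed.

Lemma class_CW V W k (D : set V) (f : V -> W) :
  class_C k.+1 D f -> class_C k D f.
Proof.
elim: k f => [|k IH] f /= [fd fD].
  by move=> x Dx; exact/differentiable_continuous/fd.
by split=> // v; exact/IH/fD.
Qed.

Lemma open_near_eq (V : topologicalType) (W : Type) (D : set V) (f g : V -> W)
    x : open D -> (forall y, D y -> f y = g y) -> D x -> \near x, f x = g x.
Proof.
move=> oD fg Dx; apply: filterS fg _; exact: open_nbhs_nbhs.
Qed.

(** Openness of [D] makes [f] and [g] agree near each point of [D], so their directional derivatives
    agree on [D] and the induction applies to those. *)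
Lemma eq_class_C V W k (D : set V) (f g : V -> W) :
  open D -> (forall x, D x -> f x = g x) -> class_C k D f -> class_C k D g.
Proof.
move=> oD; elim: k f g => [|k IH] f g fg /=.
  move=> fc x Dx; rewrite /prop_for /continuous_at -(fg x Dx).
  apply: cvg_trans (fc x Dx); apply: near_eq_cvg.
  exact: open_near_eq fg Dx.
case=> fd fD; split=> [x Dx|v].
  by apply: near_eq_differentiable (fd x Dx); exact: open_near_eq fg Dx.
apply: IH (fD v) => x Dx; apply: near_eq_derive.
exact: open_near_eq fg Dx.
Qed.

Lemma class_C_cst V W k (D : set V) (a : W) : class_C k D (fun=> a).
Proof.
elim: k a => [|k IH] a /=; first by move=> x _; exact: cvg_cst.
split=> [x _|v]; first exact: differentiable_cst.
have -> : 'D_v (fun=> a : W) = (fun=> 0).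
  by apply/funext => x; rewrite derive_cst.
exact: IH.
Qed.

Lemma class_CD V W k (D : set V) (f g : V -> W) : open D ->
  class_C k D f -> class_C k D g -> class_C k D (fun x => f x + g x).
Proof.
move=> oD; elim: k f g => [|k IH] f g /=.
  by move=> fc gc x Dx; apply: continuousD; [exact: fc|exact: gc].
move=> [fd fD] [gd gD]; split=> [x Dx|v].
  by apply: differentiableD; [exact: fd|exact: gd].
apply: eq_class_C (IH _ _ (fD v) (gD v)) => // x Dx.
by rewrite deriveD//; apply: diff_derivable; [exact: fd|exact: gd].
Qed.

(** The Leibniz rule writes the derivative with products of a derivative and a factor; the factor
    has one order to spare, which [class_CW] gives up. *)
Lemma class_CM V k (D : set V) (f g : V -> R) : open D ->
  class_C k D f -> class_C k D g -> class_C k D (fun x => f x * g x).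
Proof.
move=> oD; elim: k f g => [|k IH] f g /=.
  by move=> fc gc x Dx; apply: continuousM; [exact: fc|exact: gc].
move=> fC gC; have [fd fD] := fC; have [gd gD] := gC; split=> [x Dx|v].
  by apply: differentiableM; [exact: fd|exact: gd].
apply: (@eq_class_C _ _ _ _ (fun x => f x * 'D_v g x + g x * 'D_v f x)) => //.
  by move=> x Dx; rewrite deriveM//; apply: diff_derivable; [exact: fd|exact: gd].
by apply: class_CD => //; apply: IH => //; apply: class_CW.
Qed.

Lemma class_C_sum V W k (D : set V) (I : Type) (r : seq I) (f : I -> V -> W) :
  open D -> (forall i, class_C k D (f i)) ->
  class_C k D (fun x => \sum_(i <- r) f i x).
Proof.
move=> oD fC; elim: r => [|i r IH].
  by apply: (@eq_class_C _ _ _ _ (fun=> 0)) => // [x _|];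
    [rewrite big_nil|exact: class_C_cst].
apply: (@eq_class_C _ _ _ _ (fun x => f i x + \sum_(j <- r) f j x)) => //.
  by move=> x _; rewrite big_cons.
exact: class_CD.
Qed.

Lemma class_C_coord V m k (D : set V) (h : V -> 'rV[R]_m) (i : 'I_m) :
  open D -> class_C k D h -> class_C k D (fun x => h x 0 i : R).
Proof.
move=> oD; elim: k h => [|k IH] h /=.
  move=> hc x Dx; apply: (@continuous_comp _ _ _ h (fun y : 'rV_m => y 0 i)).
    exact: hc.
  exact: coord_continuous.
move=> [hd hD]; split=> [x Dx|v].
  apply: (@differentiable_comp _ _ _ _ h (fun y : 'rV_m => y 0 i)).
    exact: hd.
  exact: differentiable_coord.
apply: eq_class_C (IH _ (hD v)) => // x Dx.
by rewrite derive_mx ?mxE//; exact/diff_derivable/hd.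
Qed.

Lemma derive_comp V m W (f : 'rV[R]_m -> W) (h : V -> 'rV[R]_m) x v :
  differentiable h x -> differentiable f (h x) ->
  'D_v (f \o h) x = 'D_('D_v h x) f (h x).
Proof.
move=> hd fd; rewrite !deriveE//; last exact: differentiable_comp.
by rewrite diff_comp.
Qed.

Lemma derive_delta m W (f : 'rV[R]_m -> W) x a : differentiable f x ->
  'D_a f x = \sum_i a 0 i *: 'D_(delta_mx 0 i) f x.
Proof.
move=> fd; rewrite deriveE// {1}[a]row_sum_delta linear_sum.
by apply: eq_bigr => i _; rewrite linearZ deriveE.
Qed.

Lemma class_C_comp V m k (D : set V) (E : set 'rV[R]_m) (f : 'rV[R]_m -> R)
    (h : V -> 'rV[R]_m) : open D -> (forall x, D x -> E (h x)) ->
  class_C k D h -> class_C k E f -> class_C k D (f \o h).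
Proof.
move=> oD hDE; elim: k f h hDE => [|k IH] f h hDE /=.
  by move=> hc fc x Dx; apply: continuous_comp; [exact: hc|exact/fc/hDE].
move=> hC fC; have [hd hD] := hC; have [fd fD] := fC; split=> [x Dx|v].
  by apply: differentiable_comp; [exact: hd|exact/fd/hDE].
(* The chain rule differentiates [f] in the direction ['D_v h x], which moves with [x]. Expanding it
   in the standard basis leaves fixed directions, the only ones [class_C] speaks of. *)
apply: (@eq_class_C _ _ _ _ (fun x => \sum_i 'D_v h x 0 i *
    ('D_(delta_mx 0 i) f \o h) x)) => // [x Dx|].
  by rewrite derive_comp ?derive_delta//; [exact/fd/hDE|exact: hd|exact/fd/hDE].
apply: class_C_sum => // i; apply: class_CM => //; first exact: class_C_coord.
by apply: IH => //; exact: class_CW.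
Qed.

End class_C_theory.

(** * Smooth functions, tangent vectors and vector fields in charts *)

Section manifold_calculus.
Context (R : realType) (n : nat) (M : topologicalType) (A : smooth_manifold R n M).
Implicit Types (c d : chart R n M) (U V : set M) (p q : M) (f h : M -> R).
Implicit Types (X Y : vecfun R M) (v w : functional R M).

(** Inside the open range of the chart, the image is the preimage of [U] under [cinv c], which is
    continuous there. *)
Lemma chart_image_open c U : open U -> U `<=` cdom c -> open (cmap c @` U).
Proof.
move=> oU Uc; rewrite openE => _ [q Uq <-].
have cq : (cmap c @` cdom c) (cmap c q) by exists q => //; exact: Uc.
have nU : nbhs (cinv c (cmap c q)) U.
  by rewrite cmapK; [exact: open_nbhs_nbhs|exact: Uc].
have nc : nbhs (cmap c q) (cmap c @` cdom c).
  by apply: open_nbhs_nbhs; split; [exact: cran_open|].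
apply: filterS2 nc (cinv_cont cq nU) => _ [r cr <-] /=.
by rewrite cmapK// => Ur; exists r.
Qed.

Lemma chart_imageI_open c U : open U -> open (cmap c @` (U `&` cdom c)).
Proof.
move=> oU; apply: chart_image_open => [|q [//]].
by apply: openI => //; exact: cdom_open.
Qed.

Lemma smooth_onS U V f : V `<=` U -> smooth_on A U f -> smooth_on A V f.
Proof.
move=> VU fU c Ac k; apply: class_CS (fU c Ac k).
by apply: image_subset => q [Vq cq]; split => //; exact: VU.
Qed.

Lemma smooth_on_near U p f : open U -> U p -> smooth_on A U f -> smooth_near A p f.
Proof. by move=> *; exists U. Qed.

Lemma eq_smooth_on U f h : open U -> (forall q, U q -> f q = h q) ->
  smooth_on A U f -> smooth_on A U h.
Proof.
move=> oU fh fU c Ac k; apply: eq_class_C (fU c Ac k).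
  exact: chart_imageI_open.
by move=> _ [q [Uq cq] <-] /=; rewrite cmapK// fh.
Qed.

Lemma smooth_on_cst U (a : R) : smooth_on A U (fun=> a).
Proof. by move=> c Ac k; exact: class_C_cst. Qed.

Lemma smooth_onD U f h : open U -> smooth_on A U f -> smooth_on A U h ->
  smooth_on A U (fun q => f q + h q).
Proof.
move=> oU fU hU c Ac k; apply: class_CD (fU c Ac k) (hU c Ac k).
exact: chart_imageI_open.
Qed.

Lemma smooth_onM U f h : open U -> smooth_on A U f -> smooth_on A U h ->
  smooth_on A U (fun q => f q * h q).
Proof.
move=> oU fU hU c Ac k; apply: class_CM (fU c Ac k) (hU c Ac k).
exact: chart_imageI_open.
Qed.

(** One chart is enough to test smoothness: in any other chart [f] is read as its expression in [c]
    composed with a smooth transition map. *)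
Lemma smooth_on_chart c V f : atlas A c -> open V -> V `<=` cdom c ->
  class_Coo (cmap c @` V) (f \o cinv c : 'rV[R]_n -> R) -> smooth_on A V f.
Proof.
move=> Ac oV Vc fC d Ad k.
have oD := @chart_imageI_open d _ oV.
have [_ cdC] := atlas_compatible Ac Ad.
apply: (@eq_class_C _ _ _ _ _ ((f \o cinv c) \o (cmap c \o cinv d))) => //.
  by move=> _ [q [Vq dq] <-] /=; rewrite cmapK// cmapK//; exact: Vc.
apply: class_C_comp (fC k) => //.
  by move=> _ [q [Vq dq] <-] /=; rewrite cmapK//; exists q.
apply: class_CS (cdC k); apply: image_subset => q [Vq dq]; split => //.
exact: Vc.
Qed.

Lemma smooth_on_coord c i : atlas A c ->
  smooth_on A (cdom c) (fun q => cmap c q 0 i).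
Proof.
move=> Ac d Ad k; have [_ cdC] := atlas_compatible Ac Ad.
apply: (@class_C_coord _ _ _ _ _ (cmap c \o cinv d)) => //.
exact/chart_imageI_open/cdom_open.
Qed.

Lemma smooth_near_differentiable c p f : atlas A c -> cdom c p ->
  smooth_near A p f -> differentiable (f \o cinv c : 'rV[R]_n -> R) (cmap c p).
Proof.
by move=> Ac cp [U [oU Up fU]]; have [+ _] := fU c Ac 1%N; apply; exists p.
Qed.

Lemma on_smoothT p v f : smooth_near A p f -> on_smooth A p v f = v f.
Proof. by move=> fp; rewrite /on_smooth asboolT. Qed.

Lemma on_smoothF p v f : ~ smooth_near A p f -> on_smooth A p v f = 0.
Proof. by move=> fp; rewrite /on_smooth asboolF. Qed.

Lemma coord_vecE c p a : atlas A c -> cdom c p ->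
  coord_vec A c p a = \sum_i a 0 i *: coord_field A c i p.
Proof.
move=> Ac cp; apply/funext => f; rewrite fct_sumE.
(* On functions not smooth near [p] both sides are [0] by the normalization of tangent vectors; on
   the others the derivative is linear in its direction. *)
have [fp|fp] := pselect (smooth_near A p f); last first.
  rewrite [LHS]on_smoothF// big1// => i _.
  by rewrite /coord_field /coord_vec !fctE on_smoothF// scaler0.
rewrite [LHS]on_smoothT// derive_delta; last exact: smooth_near_differentiable.
apply: eq_bigr => i _.
by rewrite /coord_field /coord_vec !fctE on_smoothT.
Qed.

Lemma coord_vec_lin c p k a b : atlas A c -> cdom c p ->
  coord_vec A c p (k *: a + b) = k *: coord_vec A c p a + coord_vec A c p b.
Proof.
move=> Ac cp; rewrite !coord_vecE// scaler_sumr -big_split/=.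
by apply: eq_bigr => i _; rewrite !mxE scalerDl scalerA.
Qed.

(** Chain rule: the Jacobian of the transition map carries components in [d] to components in
    [c]. *)
Lemma coord_vec_change c d p b : atlas A c -> cdom c p -> atlas A d -> cdom d p ->
  coord_vec A d p b =
  coord_vec A c p ('D_b (cmap c \o cinv d : 'rV[R]_n -> 'rV[R]_n) (cmap d p)).
Proof.
move=> Ac cp Ad dp; apply/funext => f.
have [fp|fp] := pselect (smooth_near A p f); last by rewrite /coord_vec !on_smoothF.
rewrite /coord_vec !on_smoothT//.
have [_ cdC] := atlas_compatible Ac Ad.
have oD : open (cmap d @` (cdom c `&` cdom d)).
  exact/chart_imageI_open/cdom_open.
have Dp : (cmap d @` (cdom c `&` cdom d)) (cmap d p) by exists p.
have hp : (cmap c \o cinv d) (cmap d p) = cmap c p by rewrite /= cmapK.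
rewrite -[in RHS]hp -derive_comp.
- apply: near_eq_derive; apply: open_near_eq oD _ Dp => _ [q [cq dq] <-] /=.
  by rewrite cmapK// cmapK.
- by have [+ _] := cdC 1%N; exact.
- by rewrite hp; exact: smooth_near_differentiable.
Qed.

Lemma tangentP c p v : atlas A c -> cdom c p ->
  tangent A p v <-> exists a, v = coord_vec A c p a.
Proof.
move=> Ac cp; split=> [[d [a [Ad dp ->]]]|[a ->]]; last by exists c, a.
by rewrite (coord_vec_change a Ac cp Ad dp); eexists.
Qed.

Lemma tangent_lin p k v w : tangent A p v -> tangent A p w ->
  tangent A p (k *: v + w).
Proof.
have [c Ac cp] := atlas_cover A p.
move=> /(tangentP _ Ac cp)[a ->] /(tangentP _ Ac cp)[b ->].
by apply/(tangentP _ Ac cp); exists (k *: a + b); rewrite coord_vec_lin.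
Qed.

Lemma tangent0 p : tangent A p 0.
Proof.
have [c Ac cp] := atlas_cover A p; apply/(tangentP _ Ac cp); exists 0.
by rewrite coord_vecE// big1// => i _; rewrite mxE scale0r.
Qed.

Lemma tangentD p v w : tangent A p v -> tangent A p w -> tangent A p (v + w).
Proof. by rewrite -{2}(scale1r v); exact: tangent_lin. Qed.

Lemma tangentZ p k v : tangent A p v -> tangent A p (k *: v).
Proof.
by move=> vp; rewrite -[X in tangent A p X]addr0; exact/tangent_lin/tangent0.
Qed.

Lemma tangent_sum p (I : Type) (r : seq I) (v : I -> functional R M) :
  (forall i, tangent A p (v i)) -> tangent A p (\sum_(i <- r) v i).
Proof.
move=> vp; elim/big_rec: _ => [|i w _]; [exact: tangent0|exact/tangentD/vp].
Qed.

Lemma coord_field_tangent c i p : atlas A c -> cdom c p ->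
  tangent A p (coord_field A c i p).
Proof. by move=> Ac cp; exists c, (delta_mx 0 i). Qed.

(** Coordinate functions are dual to coordinate fields, so applying a tangent vector to them reads
    off its components. *)
Lemma coord_vec_coord c p a i : atlas A c -> cdom c p ->
  coord_vec A c p a (fun q => cmap c q 0 i) = a 0 i.
Proof.
move=> Ac cp; rewrite /coord_vec on_smoothT; last first.
  by apply: smooth_on_near (smooth_on_coord i Ac) => //; exact: cdom_open.
(* Near the point, [cmap c] undoes [cinv c], so the function differentiated is the linear
   coordinate. *)
rewrite (@near_eq_derive _ _ _ _ (fun y : 'rV[R]_n => y 0 i)).
  have := @derive_mx R 'rV[R]_n 1 n id (cmap c p) a (@derivable_id _ _ _ _).
  by move/matrixP/(_ 0 i); rewrite derive_id mxE => <-.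
have cr : (cmap c @` cdom c) (cmap c p) by exists p.
apply: open_near_eq (@cran_open _ _ _ c) _ cr => _ [q cq <-] /=.
by rewrite cmapK.
Qed.

Lemma tangentE c p v : atlas A c -> cdom c p -> tangent A p v ->
  v = \sum_i v (fun q => cmap c q 0 i) *: coord_field A c i p.
Proof.
move=> Ac cp /(tangentP _ Ac cp)[a ->]; rewrite [LHS]coord_vecE//.
by apply: eq_bigr => i _; rewrite coord_vec_coord.
Qed.

Lemma vfield_onS U V X : V `<=` U -> vfield_on A U X -> vfield_on A V X.
Proof.
move=> VU [XT XS]; split=> [p /VU /XT //|W f oW WV].
by apply: XS => //; exact: subset_trans VU.
Qed.

Lemma eq_vfield_on U X Y : (forall q, U q -> X q = Y q) ->
  vfield_on A U X -> vfield_on A U Y.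
Proof.
move=> XY [XT XS]; split=> [p Up|V f oV VU fV].
  by rewrite -XY//; exact: XT.
apply: eq_smooth_on (XS V f oV VU fV) => // q Vq.
by rewrite XY//; exact: VU.
Qed.

Lemma vfield_onD U X Y : vfield_on A U X -> vfield_on A U Y ->
  vfield_on A U (X + Y).
Proof.
move=> [XT XS] [YT YS]; split=> [p Up|V f oV VU fV].
  by apply: tangentD; [exact: XT|exact: YT].
by apply: smooth_onD => //; [exact: XS|exact: YS].
Qed.

Lemma vfield_onZ U h X : smooth_on A U h -> vfield_on A U X ->
  vfield_on A U (fun q => h q *: X q).
Proof.
move=> hU [XT XS]; split=> [p Up|V f oV VU fV].
  by apply: tangentZ; exact: XT.
by apply: smooth_onM => //; [exact: smooth_onS VU hU|exact: XS].
Qed.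

Lemma vfield_on0 U : vfield_on A U (0 : vecfun R M).
Proof.
by split=> [p Up|V f oV VU fV]; [exact: tangent0|exact: smooth_on_cst].
Qed.

Lemma vfield_on_sum U (I : Type) (r : seq I) (X : I -> vecfun R M) :
  (forall i, vfield_on A U (X i)) -> vfield_on A U (\sum_(i <- r) X i).
Proof.
by move=> XU; elim/big_rec: _ => [|i w _]; [exact: vfield_on0|exact/vfield_onD/XU].
Qed.

Lemma vfield_on_coord c i : atlas A c -> vfield_on A (cdom c) (coord_field A c i).
Proof.
move=> Ac; split=> [p cp|V f oV Vc fV]; first exact: coord_field_tangent.
apply: (smooth_on_chart Ac) => // k.
have oV' := chart_image_open oV Vc.
apply: (@eq_class_C _ _ _ _ _ (fun x => 'D_(delta_mx 0 i) (f \o cinv c) x)) => //.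
  move=> _ [q Vq <-] /=; rewrite /coord_field /coord_vec cmapK ?on_smoothT//.
    exact: smooth_on_near fV.
  exact: Vc.
(* One derivative is spent, so class [k.+1] of [f] yields class [k] of the result. *)
have [_ /(_ (delta_mx 0 i))] := fV c Ac k.+1.
by apply: class_CS; apply: image_subset => q Vq; split=> //; exact: Vc.
Qed.

End manifold_calculus.

(** * Locality, antisymmetry and linearity over smooth functions of the curvature *)

Section curvature_tensor.
Context (R : realType) (n : nat) (M : topologicalType) (A : smooth_manifold R n M).
Context (g : M -> functional R M -> functional R M -> R).
Context (nabla : vecfun R M -> vecfun R M -> vecfun R M).
Hypothesis LC : levi_civita A g nabla.
Implicit Types (c : chart R n M) (U : set M) (p q : M) (f : M -> R).
Implicit Types (X Y Z : vecfun R M).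

Lemma vfield_onB U X Y : vfield_on A U X -> vfield_on A U Y ->
  vfield_on A U (X - Y).
Proof.
move=> XU YU; apply: vfield_onD => //.
apply: (@eq_vfield_on _ _ _ _ _ (fun q => -1 *: Y q)) => [q _|].
  by rewrite scaleN1r.
by apply: vfield_onZ => //; exact: smooth_on_cst.
Qed.

Lemma nablaBl U X X' Y q : open U -> U q ->
  vfield_on A U X -> vfield_on A U X' -> vfield_on A U Y ->
  nabla (X - X') Y q = nabla X Y q - nabla X' Y q.
Proof.
move=> oU Uq XU XU' YU; apply/eqP; rewrite eq_sym subr_eq; apply/eqP.
by rewrite -(nabla_addl LC oU (vfield_onB XU XU') XU' YU)// subrK.
Qed.

Lemma lie_bracketE U X Y q : open U -> U q -> vfield_on A U X ->
  vfield_on A U Y -> lie_bracket A X Y q = nabla X Y q - nabla Y X q.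
Proof. by move=> oU Uq XU YU; rewrite (nabla_torsion_free LC oU). Qed.

Lemma vfield_on_lie_bracket U X Y : open U -> vfield_on A U X ->
  vfield_on A U Y -> vfield_on A U (lie_bracket A X Y).
Proof.
move=> oU XU YU; apply: (@eq_vfield_on _ _ _ _ _ (nabla X Y - nabla Y X)).
  by move=> q Uq; rewrite (lie_bracketE oU).
by apply: vfield_onB; exact: (nabla_vfield LC).
Qed.

Lemma curvE X Y Z q : curv A nabla X Y Z q = nabla X (nabla Y Z) q -
  nabla Y (nabla X Z) q - nabla (lie_bracket A X Y) Z q.
Proof. by []. Qed.

Lemma vfield_on_curv U X Y Z : open U -> vfield_on A U X -> vfield_on A U Y ->
  vfield_on A U Z -> vfield_on A U (curv A nabla X Y Z).
Proof.
move=> oU XU YU ZU; apply: vfield_onB; [apply: vfield_onB|];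
  apply: (nabla_vfield LC) => //; try exact: (nabla_vfield LC).
exact: vfield_on_lie_bracket.
Qed.

(** The outer [nabla] differentiates the inner one, hence the fields are compared on all of [U] and
    not at [q] alone. *)
Lemma curv_local U X X' Y Y' Z Z' q : open U -> U q ->
  vfield_on A U X -> vfield_on A U X' -> vfield_on A U Y -> vfield_on A U Y' ->
  vfield_on A U Z -> vfield_on A U Z' ->
  (forall r, U r -> X r = X' r) -> (forall r, U r -> Y r = Y' r) ->
  (forall r, U r -> Z r = Z' r) ->
  curv A nabla X Y Z q = curv A nabla X' Y' Z' q.
Proof.
move=> oU Uq XU XU' YU YU' ZU ZU' eX eY eZ.
have V := nabla_vfield LC oU; have N := nabla_local LC oU.
have W := vfield_on_lie_bracket oU.
rewrite !curvE; congr (_ - _ - _).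
- apply: (N) => //; try exact: V; by move=> r Ur; exact: N.
- apply: (N) => //; try exact: V; by move=> r Ur; exact: N.
- apply: (N) => //; try exact: W; move=> r Ur.
  by rewrite !(lie_bracketE oU)//; congr (_ - _); exact: N.
Qed.

(** Exchanging [X] and [Y] swaps the two second-derivative terms; by torsion-freeness the bracket is
    [nabla X Y - nabla Y X] on [U], which changes sign. *)
Lemma curv_anti U X Y Z q : open U -> U q ->
  vfield_on A U X -> vfield_on A U Y -> vfield_on A U Z ->
  curv A nabla X Y Z q = - curv A nabla Y X Z q.
Proof.
move=> oU Uq XU YU ZU; have W := vfield_on_lie_bracket oU.
have V := nabla_vfield LC oU.
have lieC : nabla (lie_bracket A X Y) Z q = - nabla (lie_bracket A Y X) Z q.
  rewrite (nabla_local LC oU (X' := nabla X Y - nabla Y X) (Y' := Z))//.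
  - rewrite (nabla_local LC oU (X := lie_bracket A Y X)
      (X' := nabla Y X - nabla X Y) (Y' := Z))//.
    + by rewrite !(nablaBl oU)// ?opprB//; exact: V.
    + exact: W.
    + by apply: vfield_onB; exact: V.
    + by move=> r Ur; rewrite (lie_bracketE oU).
  - exact: W.
  - by apply: vfield_onB; exact: V.
  - by move=> r Ur; rewrite (lie_bracketE oU).
by rewrite !curvE lieC; apply/funext => f; rewrite !fctE; ring.
Qed.

(** The outer [nabla] is additive at once; the inner [nabla] and the bracket are first split on all
    of [U] and substituted by [nabla_local]. *)
Lemma curv_add1 U X X' Y Z q : open U -> U q -> vfield_on A U X ->
  vfield_on A U X' -> vfield_on A U Y -> vfield_on A U Z ->
  curv A nabla (X + X') Y Z q = curv A nabla X Y Z q + curv A nabla X' Y Z q.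
Proof.
move=> oU Uq XU XU' YU ZU; have W := vfield_on_lie_bracket oU.
have V := nabla_vfield LC oU; have XXU := vfield_onD XU XU'.
rewrite !curvE (nabla_addl LC oU)//; last exact: V.
rewrite (nabla_local LC oU (X' := Y) (Y := nabla (X + X') Z)
  (Y' := nabla X Z + nabla X' Z))//; [|exact: V|by apply: vfield_onD; exact: V|].
  rewrite (nabla_addr LC oU)//; [|exact: V|exact: V].
  rewrite (nabla_local LC oU (X := lie_bracket A (X + X') Y)
    (X' := lie_bracket A X Y + lie_bracket A X' Y) (Y' := Z))//.
  - rewrite (nabla_addl LC oU)//; [|exact: W|exact: W].
    by apply/funext => f; rewrite !fctE; ring.
  - exact: W.
  - by apply: vfield_onD; exact: W.
  - move=> r Ur; rewrite [RHS]fctE !(lie_bracketE oU)//.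
    rewrite (nabla_addl LC oU)// (nabla_addr LC oU)//.
    by apply/funext => f; rewrite !fctE; ring.
by move=> r Ur; rewrite (nabla_addl LC oU).
Qed.

(* The derivative of [f] produced by [nabla Y (f X)] cancels with the one in
   [[f X, Y] = f [X, Y] - (Y f) X]. *)
Lemma curv_scale1 U f X Y Z q : open U -> U q -> smooth_on A U f ->
  vfield_on A U X -> vfield_on A U Y -> vfield_on A U Z ->
  curv A nabla (fun r => f r *: X r) Y Z q = f q *: curv A nabla X Y Z q.
Proof.
move=> oU Uq fU XU YU ZU; have W := vfield_on_lie_bracket oU.
have V := nabla_vfield LC oU; have fXU := vfield_onZ fU XU.
have YfU : smooth_on A U (fun r => Y r f) by case: YU => _; exact.
rewrite !curvE (nabla_scalel LC oU)//; last exact: V.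
rewrite (nabla_local LC oU (X' := Y) (Y := nabla (fun r => f r *: X r) Z)
  (Y' := fun r => f r *: nabla X Z r))//.
- rewrite (nabla_leibniz LC oU)//; last exact: V.
  rewrite (nabla_local LC oU (X := lie_bracket A (fun r => f r *: X r) Y)
    (X' := (fun r => f r *: lie_bracket A X Y r) - (fun r => Y r f *: X r))
    (Y' := Z))//.
  + rewrite (nablaBl oU)//.
    * rewrite (nabla_scalel LC oU)//; last exact: W.
      rewrite (nabla_scalel LC oU)//.
      by apply/funext => h; rewrite !fctE /GRing.scale/=; ring.
    * by apply: vfield_onZ => //; exact: W.
    * exact: vfield_onZ.
  + exact: W.
  + by apply: vfield_onB; apply: vfield_onZ => //; exact: W.
  + move=> r Ur; rewrite [RHS]fctE !(lie_bracketE oU)//.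
    rewrite (nabla_scalel LC oU)// (nabla_leibniz LC oU)//.
    by apply/funext => h; rewrite !fctE /GRing.scale/=; ring.
- exact: V.
- by apply: vfield_onZ => //; exact: V.
- by move=> r Ur; rewrite (nabla_scalel LC oU).
Qed.

(** Antisymmetry transfers the property from the first slot to the second; scaling is handled
    likewise below. *)
Lemma curv_add2 U X Y Y' Z q : open U -> U q -> vfield_on A U X ->
  vfield_on A U Y -> vfield_on A U Y' -> vfield_on A U Z ->
  curv A nabla X (Y + Y') Z q = curv A nabla X Y Z q + curv A nabla X Y' Z q.
Proof.
move=> oU Uq XU YU YU' ZU; rewrite !(curv_anti oU Uq XU)//; last exact: vfield_onD.
by rewrite (curv_add1 oU)// opprD.
Qed.

Lemma curv_scale2 U f X Y Z q : open U -> U q -> smooth_on A U f ->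
  vfield_on A U X -> vfield_on A U Y -> vfield_on A U Z ->
  curv A nabla X (fun r => f r *: Y r) Z q = f q *: curv A nabla X Y Z q.
Proof.
move=> oU Uq fU XU YU ZU; rewrite !(curv_anti oU Uq XU)//; last exact: vfield_onZ.
by rewrite (curv_scale1 oU)// scalerN.
Qed.

Lemma curv_add3 U X Y Z Z' q : open U -> U q -> vfield_on A U X ->
  vfield_on A U Y -> vfield_on A U Z -> vfield_on A U Z' ->
  curv A nabla X Y (Z + Z') q = curv A nabla X Y Z q + curv A nabla X Y Z' q.
Proof.
move=> oU Uq XU YU ZU ZU'; have W := vfield_on_lie_bracket oU.
have V := nabla_vfield LC oU; have ZZU := vfield_onD ZU ZU'.
have nn X1 X2 : vfield_on A U X1 -> vfield_on A U X2 ->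
    nabla X1 (nabla X2 (Z + Z')) q =
    nabla X1 (nabla X2 Z) q + nabla X1 (nabla X2 Z') q.
  move=> X1U X2U; rewrite -(nabla_addr LC oU)//; [|exact: V|exact: V].
  apply: (nabla_local LC oU) => //; [exact: V|by apply: vfield_onD; exact: V|].
  by move=> r Ur; rewrite (nabla_addr LC oU).
rewrite !curvE !nn// (nabla_addr LC oU)//; last exact: W.
by apply/funext => f; rewrite !fctE; ring.
Qed.

(** Leibniz applied twice gives mixed first-order terms symmetric in [X] and [Y], which cancel, and
    a term [(X (Y f) - Y (X f)) Z], which the bracket term [([X, Y] f) Z] removes. *)
Lemma curv_scale3 U f X Y Z q : open U -> U q -> smooth_on A U f ->
  vfield_on A U X -> vfield_on A U Y -> vfield_on A U Z ->
  curv A nabla X Y (fun r => f r *: Z r) q = f q *: curv A nabla X Y Z q.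
Proof.
move=> oU Uq fU XU YU ZU; have W := vfield_on_lie_bracket oU.
have V := nabla_vfield LC oU; have fZU := vfield_onZ fU ZU.
have nn X1 X2 : vfield_on A U X1 -> vfield_on A U X2 ->
    nabla X1 (nabla X2 (fun r => f r *: Z r)) q =
    (X1 q (fun r => X2 r f) *: Z q + X2 q f *: nabla X1 Z q) +
    (X1 q f *: nabla X2 Z q + f q *: nabla X1 (nabla X2 Z) q).
  move=> X1U X2U.
  have X2f : smooth_on A U (fun r => X2 r f) by case: X2U => _; exact.
  have vU : vfield_on A U (fun r => f r *: nabla X2 Z r).
    by apply: vfield_onZ => //; exact: V.
  have wU : vfield_on A U (fun r => X2 r f *: Z r) by exact: vfield_onZ.
  rewrite (nabla_local LC oU (X' := X1)
    (Y' := (fun r => X2 r f *: Z r) + (fun r => f r *: nabla X2 Z r)))//.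
  - by rewrite (nabla_addr LC oU)// !(nabla_leibniz LC oU)//; exact: V.
  - exact: V.
  - exact: vfield_onD.
  - by move=> r Ur; rewrite (nabla_leibniz LC oU).
(* Since [f] is smooth near [q], the bracket is not in the default branch of [on_smooth]. *)
have lieE : lie_bracket A X Y q f = X q (fun r => Y r f) - Y q (fun r => X r f).
  by rewrite /lie_bracket on_smoothT//; exact: smooth_on_near fU.
rewrite !curvE !nn// (nabla_leibniz LC oU)//; last exact: W.
by rewrite lieE; apply/funext => h; rewrite !fctE /GRing.scale/=; ring.
Qed.

End curvature_tensor.

(** * From linearity over smooth functions to dependence on values at a point *)

Section tensoriality.
Context (R : realType) (n : nat) (M : topologicalType) (A : smooth_manifold R n M).
Implicit Types (c : chart R n M) (U : set M) (p q : M) (f : M -> R).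
Implicit Types (X Y Z : vecfun R M).

(** Within a chart domain the field equals, on all of [U], a combination of coordinate fields with
    smooth coefficients. Locality substitutes it, and linearity pulls the coefficients out evaluated
    at [p]. *)
Lemma tensorial_coord c U p (T : vecfun R M -> functional R M) :
  atlas A c -> open U -> U p -> U `<=` cdom c ->
  (forall X X', vfield_on A U X -> vfield_on A U X' ->
    (forall q, U q -> X q = X' q) -> T X = T X') ->
  (forall X X', vfield_on A U X -> vfield_on A U X' -> T (X + X') = T X + T X') ->
  (forall f X, smooth_on A U f -> vfield_on A U X ->
    T (fun q => f q *: X q) = f p *: T X) ->
  forall X, vfield_on A U X ->
  T X = \sum_i X p (fun q => cmap c q 0 i) *: T (coord_field A c i).
Proof.
move=> Ac oU Up Uc Tloc Tadd Tscale X XU.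
have T0 : T 0 = 0.
  apply: (@addrI _ (T 0)); rewrite -Tadd ?addr0//; exact: vfield_on0.
have eU i : vfield_on A U (coord_field A c i).
  exact: vfield_onS Uc (vfield_on_coord i Ac).
pose x i := fun q => X q (fun q => cmap c q 0 i).
have xU i : smooth_on A U (x i).
  have [_ XS] := XU; apply: XS => //.
  exact: smooth_onS Uc (smooth_on_coord i Ac).
have xeU i : vfield_on A U (fun q => x i q *: coord_field A c i q).
  exact: vfield_onZ.
rewrite (Tloc X (\sum_i (fun q => x i q *: coord_field A c i q)))//.
- transitivity (\sum_i T (fun q => x i q *: coord_field A c i q)); last first.
    by apply: eq_bigr => i _; rewrite Tscale.
  elim: (index_enum _) => [|i r IH]; first by rewrite !big_nil.
  by rewrite !big_cons Tadd ?IH//; exact: vfield_on_sum.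
- exact: vfield_on_sum.
- move=> q Uq; rewrite fct_sumE; apply: tangentE => //; first exact: Uc.
  by have [+ _] := XU; exact.
Qed.

End tensoriality.

(** * Real vectors related by a complex scalar *)

Lemma complex_quotient (R : realType) (theta : R[i]) (x y : R) : y != 0 ->
  x%:C = theta * y%:C -> theta = (x / y)%:C.
Proof.
move=> y0 xy; rewrite rmorphM/= xy fmorphV/= mulfK//.
by apply: contra y0 => /eqP[->].
Qed.

Lemma complex_multiple_real (R : realType) (M : topologicalType)
    (w v : functional R M) (theta : R[i]) : v != 0 -> complex_multiple w theta v ->
  exists2 r : R, theta = r%:C & w = r *: v.
Proof.
(* Evaluating the equation at a function where [v] does not vanish exhibits [theta] as a quotient of
   two reals. *)
move=> v0 wv; have [f vf] : exists f, v f != 0.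
  apply: contrapT => v0'; move/eqP: v0; apply; apply/funext => f.
  by apply: contrapT => /eqP vf; apply: v0'; exists f.
have := complex_quotient vf (wv f); set r := _ / _ => thetaE; exists r => //.
apply/funext => h; have := wv h.
by rewrite thetaE -rmorphM => -[].
Qed.

(** * Bilinearity of the metric on tangent vectors *)

Section M_eigenvalues.
Context (R : realType) (n : nat) (M : topologicalType) (A : smooth_manifold R n M).
Context (g : M -> functional R M -> functional R M -> R).
Context (nabla : vecfun R M -> vecfun R M -> vecfun R M).
Hypothesis G : riemannian_metric A g.
Hypothesis LC : levi_civita A g nabla.
Implicit Types (U : set M) (X Y Z : vecfun R M) (v w : functional R M).

Lemma metric0l p w : tangent A p w -> g p 0 w = 0.
Proof.
have T0 := tangent0 A p.
move=> wT; have := metric_lin G 1 T0 T0 wT.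
by rewrite scaler0 addr0 mul1r => /eqP; rewrite -subr_eq subrr => /eqP.
Qed.

Lemma metricDr p u v w : tangent A p u -> tangent A p v -> tangent A p w ->
  g p w (u + v) = g p w u + g p w v.
Proof.
move=> uT vT wT; have := metric_lin G 1 uT vT wT.
by rewrite scale1r mul1r !(Defs.metric_sym G wT)//; exact: tangentD.
Qed.

Lemma metricZr p k v w : tangent A p v -> tangent A p w ->
  g p w (k *: v) = k * g p w v.
Proof.
move=> vT wT; have := metric_lin G k vT (tangent0 A p) wT.
by rewrite !addr0 metric0l// addr0 !(Defs.metric_sym G wT)//; exact: tangentZ.
Qed.

Lemma metric_sumr p (I : Type) (r : seq I) (k : I -> R)
    (v : I -> functional R M) w : tangent A p w -> (forall i, tangent A p (v i)) ->
  g p w (\sum_(i <- r) k i *: v i) = \sum_(i <- r) k i * g p w (v i).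
Proof.
move=> wT vT; have kT i : tangent A p (k i *: v i) by exact: tangentZ.
elim: r => [|i r IH].
  by rewrite !big_nil (Defs.metric_sym G)//; [exact: metric0l|exact: tangent0].
by rewrite !big_cons metricDr ?IH ?metricZr//; exact: tangent_sum.
Qed.

(** * Curvature and the M-eigenvalue equations in a chart around the point *)

Section at_a_point.
Variables (c : chart R n M) (p : M).
Hypotheses (Ac : atlas A c) (cp : cdom c p).

Local Notation e i := (coord_field A c i).
Local Notation cv a := (coord_vec A c p a).

Let eT i : tangent A p (e i p). Proof. exact: coord_field_tangent. Qed.
Let eV i : vfield_on A (cdom c) (e i). Proof. exact: vfield_on_coord. Qed.

Lemma coord_vec_tangent a : tangent A p (cv a).
Proof. by exists c, a. Qed.

Lemma curv_coord_tangent i j k : tangent A p (curv A nabla (e i) (e j) (e k) p).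
Proof.
by have [+ _] := vfield_on_curv LC (cdom_open c) (eV i) (eV j) (eV k); exact.
Qed.

(** After shrinking [U] into the chart domain, the slots [Z], [X], [Y] are expanded one at a time.
    This order gives them the indices [i], [j], [k] of [R_{hijk}]. *)
Lemma curv_coordE U X Y Z : open U -> U p ->
  vfield_on A U X -> vfield_on A U Y -> vfield_on A U Z ->
  curv A nabla X Y Z p = \sum_i \sum_j \sum_k
    (Z p (fun q => cmap c q 0 i) * X p (fun q => cmap c q 0 j) *
     Y p (fun q => cmap c q 0 k)) *: curv A nabla (e j) (e k) (e i) p.
Proof.
move=> oU Up XU YU ZU; pose V := U `&` cdom c.
have oV : open V by apply: openI => //; exact: cdom_open.
have VU : V `<=` U by move=> q [].
have Vc : V `<=` cdom c by move=> q [].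
have Vp : V p by [].
have XV := vfield_onS VU XU; have YV := vfield_onS VU YU.
have ZV := vfield_onS VU ZU; have eVV i := vfield_onS Vc (eV i).
rewrite (tensorial_coord (T := fun Z => curv A nabla X Y Z p) Ac oV Vp Vc _ _ _ ZV);
  last first.
- by move=> f Z' fV Z'V; exact: (curv_scale3 LC oV).
- by move=> Z1 Z2 Z1V Z2V; exact: (curv_add3 LC oV).
- by move=> Z1 Z2 Z1V Z2V Z12; exact: (curv_local LC oV).
apply: eq_bigr => i _.
rewrite (tensorial_coord (T := fun X => curv A nabla X Y (e i) p) Ac oV Vp Vc
  _ _ _ XV); last first.
- by move=> f Z' fV Z'V; exact: (curv_scale1 LC oV).
- by move=> Z1 Z2 Z1V Z2V; exact: (curv_add1 LC oV).
- by move=> Z1 Z2 Z1V Z2V Z12; exact: (curv_local LC oV).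
rewrite scaler_sumr; apply: eq_bigr => j _.
rewrite (tensorial_coord (T := fun Y => curv A nabla (e j) Y (e i) p) Ac oV Vp Vc
  _ _ _ YV); last first.
- by move=> f Z' fV Z'V; exact: (curv_scale2 LC oV).
- by move=> Z1 Z2 Z1V Z2V; exact: (curv_add2 LC oV).
- by move=> Z1 Z2 Z1V Z2V Z12; exact: (curv_local LC oV).
by rewrite !scaler_sumr; apply: eq_bigr => k _; rewrite !scalerA.
Qed.

Lemma coord_vec_extension a : exists2 X, vfield_on A (cdom c) X & X p = cv a.
Proof.
exists (\sum_i (fun q => a 0 i *: e i q)).
  apply: vfield_on_sum => i; apply: vfield_onZ => //.
  exact: smooth_on_cst.
by rewrite fct_sumE coord_vecE.
Qed.

Lemma curv_atE x y z :
  curv_at A nabla p (cv x) (cv y) (cv z) = \sum_i \sum_j \sum_k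
    (z 0 i * x 0 j * y 0 k) *: curv A nabla (e j) (e k) (e i) p.
Proof.
rewrite /curv_at; case: xgetP => [w _|no].
  (* Whatever extensions underlie the value picked by [xget], the expansion sees only their values
     at [p]. *)
  move=> [U [X [Y [Z [oU Up [XU YU ZU] [Xp Yp Zp] ->]]]]].
  rewrite (curv_coordE oU)//; apply: eq_bigr => i _; apply: eq_bigr => j _.
  by apply: eq_bigr => k _; rewrite Xp Yp Zp !coord_vec_coord.
(* The default value [0] of [xget] is excluded because constant-coefficient extensions exist on the
   chart domain. *)
have [X XU Xp] := coord_vec_extension x.
have [Y YU Yp] := coord_vec_extension y.
have [Z ZU Zp] := coord_vec_extension z.
exfalso; apply: (no (curv A nabla X Y Z p)).
by exists (cdom c), X, Y, Z; split => //; exact: cdom_open.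
Qed.

Lemma curv_at_tangent x y z :
  tangent A p (curv_at A nabla p (cv x) (cv y) (cv z)).
Proof.
rewrite curv_atE; do 3![apply: tangent_sum => ?].
exact/tangentZ/curv_coord_tangent.
Qed.

Lemma curv_at_diag x z : curv_at A nabla p (cv x) (cv x) (cv z) = 0.
Proof.
rewrite curv_atE big1// => i _; set S := (X in X = _).
(* For fixed [i] the weights are symmetric in [j], [k] and the curvature vectors antisymmetric, so
   exchanging the sums flips the sign. *)
have SN : S = - S.
  rewrite {1}/S exchange_big/= -sumrN; apply: eq_bigr => k _.
  rewrite -sumrN; apply: eq_bigr => j _.
  rewrite (curv_anti LC (cdom_open c) cp (eV j) (eV k) (eV i)) scalerN.
  by rewrite -!mulrA (mulrC (x 0 j)).
apply/funext => f; have /(congr1 (fun F => F f)) := SN.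
by rewrite !fctE => /eqP; rewrite -addr_eq0 -mulr2n mulrn_eq0 => /eqP.
Qed.

Lemma metric_coord_vec h a :
  g p (e h p) (cv a) = \sum_l metric_coef A g c p h l * a 0 l.
Proof.
rewrite coord_vecE// metric_sumr//.
by apply: eq_bigr => l _; rewrite mulrC.
Qed.

Lemma metric_norm a :
  g p (cv a) (cv a) = \sum_i \sum_j metric_coef A g c p i j * a 0 i * a 0 j.
Proof.
have aT := coord_vec_tangent a.
rewrite {2}coord_vecE// metric_sumr//; apply: eq_bigr => i _.
rewrite (Defs.metric_sym G)// metric_coord_vec mulr_sumr.
by apply: eq_bigr => j _; rewrite mulrCA mulrA.
Qed.

Lemma metric_curv_at h x y z :
  g p (e h p) (curv_at A nabla p (cv x) (cv y) (cv z)) =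
  \sum_i \sum_j \sum_k
    curv_coef A g nabla c p h i j k * z 0 i * x 0 j * y 0 k.
Proof.
have kT i j k a : tangent A p (a *: curv A nabla (e j) (e k) (e i) p).
  exact/tangentZ/curv_coord_tangent.
have sumE (F : 'I_n -> functional R M) : (forall i, tangent A p (F i)) ->
    g p (e h p) (\sum_i F i) = \sum_i g p (e h p) (F i).
  move=> FT; have := @metric_sumr p _ (index_enum 'I_n) (fun=> 1) F _ (eT h) FT.
  under eq_bigr do rewrite scale1r.
  by under [in RHS]eq_bigr do rewrite mul1r.
rewrite curv_atE sumE => [|i]; last by do 2![apply: tangent_sum => ?].
apply: eq_bigr => i _; rewrite sumE => [|j]; last by apply: tangent_sum => ?.
apply: eq_bigr => j _; rewrite sumE//; apply: eq_bigr => k _.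
rewrite metricZr//; last exact: curv_coord_tangent.
by rewrite mulrC !mulrA.
Qed.

(** Expanding one copy of [w] in the coordinate fields would give [g p w w = 0], against
    positivity. *)
Lemma metric_nondegenerate w : tangent A p w ->
  (forall h, g p (e h p) w = 0) -> w = 0.
Proof.
move=> wT w0; apply/eqP/negP => /negP wn0.
have := metric_pos G wT wn0; rewrite {2}(tangentE Ac cp wT).
rewrite metric_sumr// big1 ?ltxx// => i _.
by rewrite (Defs.metric_sym G)// w0 mulr0.
Qed.

Lemma metric_unit_neq0 v : g p v v = 1 -> v != 0.
Proof.
apply: contra_eq_neq => ->; rewrite metric0l; last exact: tangent0.
by rewrite eq_sym oner_neq0.
Qed.

Lemma coord_eigen_eq (theta : R[i]) x y z b : g p (cv b) (cv b) = 1 ->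
  complex_multiple (curv_at A nabla p (cv x) (cv y) (cv z)) theta (cv b) <->
  forall h, (\sum_i \sum_j \sum_k
      curv_coef A g nabla c p h i j k * z 0 i * x 0 j * y 0 k)%:C =
    theta * (\sum_l metric_coef A g c p h l * b 0 l)%:C.
Proof.
move=> b1; have bT := coord_vec_tangent b; split=> [E h|E].
  (* The unit vector [cv b] is nonzero, so [theta] is real and the equation can be paired with [e h]
     by real bilinearity. *)
  have [r -> Er] := complex_multiple_real (metric_unit_neq0 b1) E.
  by rewrite -metric_curv_at Er metricZr// metric_coord_vec rmorphM.
(* By nondegeneracy the unit vector [cv b] has a nonzero covariant component; the equation of that
   index makes [theta] a real [r]. *)
have [h bh] : exists h, \sum_l metric_coef A g c p h l * b 0 l != 0.
  apply: contrapT => b0; have /eqP[] := metric_unit_neq0 b1.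
  apply: metric_nondegenerate => // h; rewrite metric_coord_vec.
  by apply: contrapT => /eqP bh; apply: b0; exists h.
have := complex_quotient bh (E h); set r := _ / _ => thetaE.
have wT := curv_at_tangent x y z.
suff -> : curv_at A nabla p (cv x) (cv y) (cv z) = r *: cv b.
  by move=> f; rewrite thetaE -rmorphM.
(* The component equations say that both sides pair equally with every coordinate field, so their
   difference is zero. *)
apply/eqP; rewrite -subr_eq0 addrC -scaleNr; apply/eqP.
apply: metric_nondegenerate => [|k]; first exact: tangent_lin.
rewrite metricDr//; last exact: tangentZ.
rewrite metricZr// metric_curv_at metric_coord_vec.
have := E k; rewrite thetaE -rmorphM => -[->].
by rewrite mulNr addNr.
Qed.

(** The intrinsic set mentions no chart, so this identification yields invariance under change of
    coordinates. *)
Lemma coord_M_eigenvaluesE :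
  coord_M_eigenvalues A g nabla c p = M_eigenvalues A g nabla p.
Proof.
apply/seteqP; split=> theta /=.
  move=> [a [b [Eb Ea a1 b1]]]; rewrite -!metric_norm in a1 b1.
  exists (cv a), (cv b); split => //; first by split; exact: coord_vec_tangent.
  - exact/coord_eigen_eq.
  - exact/coord_eigen_eq.
move=> [u [v [[uT vT] Ev Eu [u1 v1]]]].
have [a aE] := (tangentP _ Ac cp).1 uT; have [b bE] := (tangentP _ Ac cp).1 vT.
subst u v; exists a, b; split; rewrite -?metric_norm//.
- exact/coord_eigen_eq.
- exact/coord_eigen_eq.
Qed.

Lemma unit_tangent_exists : (1 <= n)%N -> exists a, g p (cv a) (cv a) = 1.
Proof.
(* The all-ones vector is nonzero: [n1] provides the index [0], and the derivative of that
   coordinate function along it is [1]. Dividing by the norm then makes it a unit vector. *)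
move=> n1; pose a : 'rV[R]_n := const_mx 1; pose i := Ordinal n1.
have aT := coord_vec_tangent a.
have a0 : cv a != 0.
  apply/eqP => /(congr1 (fun F => F (fun q => cmap c q 0 i))).
  by rewrite coord_vec_coord// mxE => /eqP; rewrite oner_eq0.
have N0 := metric_pos G aT a0; set N := g p _ _ in N0.
exists ((Num.sqrt N)^-1 *: a).
have -> : cv ((Num.sqrt N)^-1 *: a) = (Num.sqrt N)^-1 *: cv a.
  rewrite !coord_vecE// scaler_sumr; apply: eq_bigr => j _.
  by rewrite mxE scalerA.
have kT := tangentZ (Num.sqrt N)^-1 aT.
rewrite metricZr// (Defs.metric_sym G)// metricZr// -/N mulrA -expr2 exprVn.
by rewrite sqr_sqrtr ?ltW// mulVf// gt_eqF.
Qed.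

End at_a_point.
End M_eigenvalues.

Theorem mainTheorem1 (R : realType) (n : nat) (M : topologicalType)
    (A : smooth_manifold R n M)
    (g : M -> functional R M -> functional R M -> R)
    (nabla : vecfun R M -> vecfun R M -> vecfun R M) (p : M) :
  (1 <= n)%N ->
  riemannian_metric A g ->
  levi_civita A g nabla ->
  [/\ exists theta : R[i], M_eigenvalues A g nabla p theta,
      forall theta : R[i], M_eigenvalues A g nabla p theta ->
        exists r : R, theta = r%:C
    & forall c c' : chart R n M,
        atlas A c -> cdom c p -> atlas A c' -> cdom c' p ->
        coord_M_eigenvalues A g nabla c p = M_eigenvalues A g nabla p /\
        coord_M_eigenvalues A g nabla c p = coord_M_eigenvalues A g nabla c' p].
Proof.
move=> n1 G LC; have [c Ac cp] := atlas_cover A p; split.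
- have [a a1] := unit_tangent_exists G Ac cp n1.
  have aT := coord_vec_tangent Ac cp a.
  exists 0, (coord_vec A c p a), (coord_vec A c p a).
  by split => // f; rewrite (curv_at_diag LC)// mul0r.
(* The unit norm makes [v] nonzero, so the first eigenvalue equation forces [theta] to be real. *)
- move=> theta [u [v [[uT vT] uv _ [_ v1]]]].
  have [r -> _] := complex_multiple_real (metric_unit_neq0 G v1) uv.
  by exists r.
- by move=> d d' Ad dp Ad' dp'; rewrite !coord_M_eigenvaluesE.
Qed.
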